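(* If $T$ is a strongly connected tournament on $n\ge 3$ vertices, then $3\le\overrightarrow{trc}(T)\le\overrightarrow{strc}(T)\le 2n-3$.
   Context: A tournament is a digraph in which every two distinct vertices are joined by exactly one arc (in one direction), with no loops. Strongly connected means every ordered pair $(u,v)$ is joined by a directed $u$–$v$ path; a geodesic is a shortest directed path. A directed path is total-rainbow if its arcs and internal vertices all receive pairwise distinct colours under a total-colouring (colouring of vertices and arcs). $\overrightarrow{trc}(D)$ (resp. $\overrightarrow{strc}(D)$) is the minimum number of colours in a total-colouring of $D$ such that every ordered pair $(u,v)$ is joined by a total-rainbow $u$–$v$ path (resp. total-rainbow $u$–$v$ geodesic). *)

(* Defs.v *)
From mathcomp Require Import all_boot.

Set Implicit Arguments.
Unset Strict Implicit.
Unset Printing Implicit Defensive.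

Section TotalRainbow.

Variable V : finType.
Implicit Types (e : rel V) (u v : V) (p : seq V).

Definition tournament e :=
  irreflexive e /\ (forall u v, u != v -> e u v (+) e v u).

Definition strongly_connected e := forall u v, connect e u v.

(* The path u :: p has pairwise distinct vertices; the trivial path p = [::]
   is the only one from u to itself. *)
Definition dipath e u v p := [&& path e u p, last u p == v & uniq (u :: p)].

(* A directed path has fewer than #|V| arcs, so bounded sequences cover all
   the paths compared here (see geodesicP). *)
Definition geodesic e u v p :=
  dipath e u v p &&
  [forall q : #|V|.-bseq V, dipath e u v q ==> (size p <= size q)].

Definition arcs u p : seq (V * V) := zip (u :: p) p.

Definition internal u p : seq V := behead (belast u p).

(* A total-colouring with k colours colours the vertices (inl) and the ordered
   pairs of vertices (inr); the colours of the pairs that are not arcs are never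
   looked at. *)
Definition colouring k := {ffun V + V * V -> 'I_k}.

Definition total_rainbow k (c : colouring k) u p :=
  uniq (map c (map inr (arcs u p) ++ map inl (internal u p))).

Definition total_rainbow_connected e k (c : colouring k) :=
  [forall u, forall v, exists p : #|V|.-bseq V,
    dipath e u v p && total_rainbow c u p].

Definition strongly_total_rainbow_connected e k (c : colouring k) :=
  [forall u, forall v, exists p : #|V|.-bseq V,
    geodesic e u v p && total_rainbow c u p].

Lemma dipath_size e u v p : dipath e u v p -> size p <= #|V|.
Proof.
case/and3P=> _ _ up; apply: leq_trans (leqnSn _) _.
by rewrite -[(size p).+1]/(size (u :: p)) -(card_uniqP up) max_card.
Qed.

Lemma geodesicP e u v p :
  reflect (dipath e u v p /\ forall q, dipath e u v q -> size p <= size q)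
          (geodesic e u v p).
Proof.
apply: (iffP andP) => -[dp minp]; split=> //.
  by move=> q dq; have /implyP := forallP minp (Bseq (dipath_size dq)); apply.
by apply/forallP=> q; apply/implyP; apply: minp.
Qed.

Lemma total_rainbow_connectedP e k (c : colouring k) :
  reflect (forall u v, exists2 p, dipath e u v p & total_rainbow c u p)
          (total_rainbow_connected e c).
Proof.
apply: (iffP forallP) => [H u v|H u].
  by have /forallP/(_ v)/existsP[p /andP[]] := H u; exists p.
apply/forallP=> v; have [p dp rp] := H u v; apply/existsP.
by exists (Bseq (dipath_size dp)); rewrite /= dp.
Qed.

Lemma strongly_total_rainbow_connectedP e k (c : colouring k) :
  reflect (forall u v, exists2 p, geodesic e u v p & total_rainbow c u p)
          (strongly_total_rainbow_connected e c).
Proof.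
apply: (iffP forallP) => [H u v|H u].
  by have /forallP/(_ v)/existsP[p /andP[]] := H u; exists p.
apply/forallP=> v; have [p gp rp] := H u v; apply/existsP.
have [dp _] := geodesicP _ _ _ _ gp.
by exists (Bseq (dipath_size dp)); rewrite /= gp.
Qed.

Lemma geodesic_exists e u v : connect e u v -> exists p, geodesic e u v p.
Proof.
case/connectP=> p0 /shortenP[p pp up _] ->.
have dp : dipath e u (last u p) p by rewrite /dipath pp eqxx.
pose P (q : #|V|.-bseq V) := dipath e u (last u p) q.
case: (@arg_minnP _ (Bseq (dipath_size dp)) P (fun q => size q) dp) => q dq mq.
exists q; apply/andP; split=> //; apply/forallP=> r; apply/implyP; exact: mq.
Qed.

Lemma dipath_uniq_elements e u v p : dipath e u v p ->
  uniq (map inr (arcs u p) ++ map inl (internal u p) : seq (V + V * V)).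
Proof.
case/and3P=> _ _ up; rewrite cat_uniq !map_inj_uniq; try by move=> ? ? [].
apply/and3P; split.
- apply: (@map_uniq _ _ snd); rewrite -/unzip2 unzip2_zip ?leqW //.
  by case/andP: up.
- by apply/hasPn=> _ /mapP[x _ ->]; apply/mapP=> -[].
- move: up; rewrite lastI rcons_uniq /internal => /andP[_].
  by case: (belast u p) => //= a s /andP[].
Qed.

Lemma strc_exists e : strongly_connected e ->
  exists k, [exists c : colouring k, strongly_total_rainbow_connected e c].
Proof.
move=> sc; exists #|{: V + V * V}|; apply/existsP.
exists [ffun x => enum_rank x]; apply/strongly_total_rainbow_connectedP=> u v.
have [p gp] := geodesic_exists (sc u v); exists p => //.
have [dp _] := geodesicP _ _ _ _ gp.
rewrite /total_rainbow map_inj_uniq; first exact: dipath_uniq_elements dp.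
by move=> x y; rewrite !ffunE => /enum_rank_inj.
Qed.

Lemma trc_exists e : strongly_connected e ->
  exists k, [exists c : colouring k, total_rainbow_connected e c].
Proof.
move=> /strc_exists[k /existsP[c /strongly_total_rainbow_connectedP H]].
exists k; apply/existsP; exists c; apply/total_rainbow_connectedP=> u v.
by have [p /andP[dp _] rp] := H u v; exists p.
Qed.

Definition trc e (sc : strongly_connected e) : nat := ex_minn (trc_exists sc).

Definition strc e (sc : strongly_connected e) : nat := ex_minn (strc_exists sc).

End TotalRainbow.

(* Main.v *)
(* Upper bound: let d be the diameter.  If d <= 2, colour every arc by its head
   and every vertex by one of its in-neighbours; the vertices are then the only
   colours.  Otherwise start from one colour for the arcs into each vertex and
   another one for the vertex itself, and save three of these 2 #|V| colours.
   If dist y z >= 3 then z -> y, and on a geodesic meeting both y and z outside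
   its origin, y comes before z.  Hence when dist u v = d, no geodesic enters
   both u and v, and their arc colours can be merged; likewise no geodesic has
   y and z as internal vertices as soon as dist y z >= d - 1, and their vertex
   colours can be merged.  For d >= 4, this applies to u and the vertex before
   v on a u-v geodesic, and to the vertex after u and v.  For d = 3, either two
   pairs at distance 3 are disjoint, or all these pairs meet and the vertex
   colours of some triple can be merged. *)
Require Import Defs.
From mathcomp Require Import all_boot.
From mathcomp Require Import zify.

Section Distance.

Variables (V : finType) (e : rel V) (sc : strongly_connected e).
Implicit Types (u v w x y z : V) (p q : seq V).

(** * Distances and how they add up along geodesics *)

Definition dist u v : nat := size (xchoose (geodesic_exists (sc u v))).

Lemma geodesic_size u v p : geodesic e u v p -> size p = dist u v.
Proof.
move=> /geodesicP[dp minp].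
have /geodesicP[dq minq] := xchooseP (geodesic_exists (sc u v)).
by apply/eqP; rewrite eqn_leq minp // minq.
Qed.

Lemma dist_path u p : path e u p -> dist u (last u p) <= size p.
Proof.
case/shortenP=> q pq uq sub_qp.
have /geodesicP[_ minp] := xchooseP (geodesic_exists (sc u (last u q))).
apply: (@leq_trans (size q)); first by apply: minp; rewrite /dipath pq eqxx.
by apply: uniq_leq_size sub_qp; case/andP: uq.
Qed.

Lemma dist_pathP u v :
  exists p, [/\ path e u p, last u p = v & size p = dist u v].
Proof.
have /geodesicP[/and3P[pp /eqP lp _] _] := xchooseP (geodesic_exists (sc u v)).
by exists (xchoose (geodesic_exists (sc u v))).
Qed.

Lemma dist_triangle v u w : dist u w <= dist u v + dist v w.
Proof.
have [p [pp <- <-]] := dist_pathP u v.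
have [q [pq <- <-]] := dist_pathP (last u p) w.
by rewrite -last_cat -size_cat dist_path // cat_path pp.
Qed.

Lemma dist_refl u : dist u u = 0.
Proof. by apply/eqP; rewrite -leqn0 (@dist_path u [::]). Qed.

Lemma dist_arc u v : e u v -> dist u v <= 1.
Proof. by move=> euv; apply: (@dist_path u [:: v]); rewrite /= euv. Qed.

Lemma dist_gt0 u v : (0 < dist u v) = (u != v).
Proof.
have [->|neq_uv] := eqVneq u v; first by rewrite dist_refl.
have [[|x p] [_ /= lp <-]] := dist_pathP u v => //.
by rewrite lp eqxx in neq_uv.
Qed.

(** The triangle inequality squeezes: each piece bounds its distance from above, and the two
    distances must add up to at least the whole. *)
Lemma dist_cat u p q (v := last u p) (w := last v q) :
    path e u (p ++ q) -> size (p ++ q) = dist u w ->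
  dist u v = size p /\ dist v w = size q.
Proof.
rewrite cat_path size_cat => /andP[/dist_path pp /dist_path pq] size_pq.
have := dist_triangle v u w; rewrite -/v in pp pq; rewrite -/w in pq.
by move=> ?; lia.
Qed.

Lemma dist_succ u v k : dist u v = k.+1 -> exists2 x, e u x & dist x v = k.
Proof.
have [p [pp <- sp]] := dist_pathP u v; rewrite -sp.
case: p pp sp => //= x p /[dup] pp /andP[eux _] sp [<-]; exists x => //.
by have [_ ->] := @dist_cat u [:: x] p pp sp.
Qed.

Lemma dist_pred u v k : dist u v = k.+1 -> exists2 x, e x v & dist u x = k.
Proof.
have [p [pp <- sp]] := dist_pathP u v; rewrite -sp.
case/lastP: p pp sp => // p x; rewrite size_rcons last_rcons.
move=> /[dup] pp; rewrite rcons_path => /andP[_ exv] sp [<-].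
exists (last u p) => //; rewrite -cats1 in pp.
by have [] := dist_cat _ _ _ pp; rewrite //= size_cat addn1.
Qed.

Lemma dist_mem u p y : path e u p -> size p = dist u (last u p) ->
  y \in u :: p -> dist u (last u p) = dist u y + dist y (last u p).
Proof.
move=> pp + yp; case/splitPl: yp pp => p1 p2 <- pp sp.
by have := dist_cat _ _ _ pp; rewrite -last_cat => /(_ sp)[-> ->];
  rewrite -size_cat.
Qed.

(** Cutting at [y] leaves [z] in one of the halves, where [dist_mem] applies; the half decides the
    order. *)
Lemma geodesic_mem2 u v p y z : geodesic e u v p -> y \in p -> z \in p ->
  dist u v = dist u y + dist y z + dist z v \/
  dist u v = dist u z + dist z y + dist y v.
Proof.
move=> gp yp zp; have sp := geodesic_size _ _ _ gp.
have /geodesicP[/and3P[pp /eqP lp _] _] := gp.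
move: (mem_behead (s := u :: p) yp) (mem_behead (s := u :: p) zp) => {}yp.
rewrite -{}lp in sp *; case/splitPl: yp pp sp => p1 p2 lp1 pp sp.
have:= dist_cat _ _ _ pp; rewrite -last_cat => /(_ sp)[]; rewrite lp1 => s1 s2.
move: pp sp; rewrite cat_path size_cat last_cat lp1 => /andP[pp1 pp2] sp.
rewrite last_cat lp1 in s2; rewrite -cat_cons mem_cat => /orP[zp1|zp2].
  have := dist_mem _ _ _ pp1; rewrite lp1 => /(_ z (esym s1) zp1) ?.
  by right; lia.
have := dist_mem _ _ _ pp2 (esym s2) (mem_behead (s := y :: p2) zp2) => ?.
by left; lia.
Qed.

(** * Geodesics in a tournament *)

Hypothesis tour : tournament e.

Lemma arc_irrefl x : e x x = false. Proof. exact: (proj1 tour). Qed.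

Lemma dist_ge2 u v : 2 <= dist u v -> e v u.
Proof.
move=> d2; have neq_uv : u != v by rewrite -dist_gt0 ltnW.
have := proj2 tour u v neq_uv; case euv: (e u v) => //.
by have := dist_arc _ _ euv; lia.
Qed.

(* If z came first, the predecessor x of z on the geodesic would not dominate
   y, so y -> x -> z, whence dist y z <= 2. *)
Lemma geodesic_order u v p y z : geodesic e u v p -> y \in p -> z \in p ->
  3 <= dist y z -> dist u v = dist u y + dist y z + dist z v.
Proof.
move=> gp yp zp d3; have [//|duv] := geodesic_mem2 _ _ _ _ _ gp yp zp.
have /geodesicP[/and3P[_ _ /= /andP[uNp _]] _] := gp.
have : 0 < dist u z by rewrite dist_gt0; apply: contraNneq uNp => ->.
case duz: (dist u z) => [//|k] _.
have [x exz dux] := dist_pred _ _ _ duz.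
have dzy : 0 < dist z y.
  by rewrite dist_gt0; apply: contraTneq d3 => ->; rewrite dist_refl.
have := dist_triangle y u v; have := dist_triangle x u y => tx ty.
have /dist_ge2 eyx : 2 <= dist x y by lia.
have := dist_triangle x y z; have := dist_arc _ _ eyx.
by have := dist_arc _ _ exz; lia.
Qed.

(** The condition under which [y] and [z] may share a vertex colour. *)
Definition internally_apart y z := forall u v p, geodesic e u v p ->
  ~~ ((y \in internal u p) && (z \in internal u p)).

Lemma internally_apartC y z : internally_apart y z -> internally_apart z y.
Proof. by move=> H u v p /H; rewrite andbC. Qed.

Lemma geodesic_internal u v p y : geodesic e u v p -> y \in internal u p ->
  [/\ y \in p, 0 < dist u y & 0 < dist y v].
Proof.
move=> /geodesicP[/and3P[_ /eqP <- +] _]; rewrite !dist_gt0 /internal.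
case: p => //= a p /andP[uNp up] yp.
have yap : y \in a :: p by rewrite lastI mem_rcons inE yp orbT.
split=> //; first by apply: contraNneq uNp => ->.
by move: up; rewrite -[_ && _]/(uniq (a :: p)) lastI rcons_uniq => /andP[+ _];
  apply: contraNneq => <-.
Qed.

(** By [geodesic_order], [y] precedes [z]; at least one more arc on each side makes the geodesic too
    long. *)
Lemma internally_apart_far y z :
  3 <= dist y z -> (forall u v, dist u v <= (dist y z).+1) ->
  internally_apart y z.
Proof.
move=> d3 dmax u v p gp; apply/negP => /andP[yi zi].
have [yp uy _] := geodesic_internal _ _ _ _ gp yi.
have [zp _ zv] := geodesic_internal _ _ _ _ gp zi.
have := geodesic_order _ _ _ _ _ gp yp zp d3; have := dmax u v; lia.
Qed.

(** * Bounding [strc] by explicit colourings *)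

Lemma strc_le (T : finType) (F : V + V * V -> T) k :
    0 < k -> #|[set F x | x in setT]| <= k ->
    (forall u v, exists2 p, geodesic e u v p &
       uniq (map F (map inr (arcs u p) ++ map inl (internal u p)))) ->
  strc sc <= k.
Proof.
case: k => // k _ leFk geoF; rewrite /strc; case: ex_minnP => m _; apply.
(* Colours become positions in the list of values of [F]; [idxS] keeps them below [k.+1], so [inord]
   never uses its default. *)
set S := enum [set F x | x in setT].
have idxS (a : V + V * V) : index (F a) S < k.+1.
  apply: leq_trans leFk; rewrite cardE index_mem mem_enum.
  by apply: imset_f.
apply/existsP; exists [ffun a => inord (index (F a) S)].
apply/strongly_total_rainbow_connectedP => u v; have [p gp up] := geoF u v.
exists p => //; apply: (@map_uniq _ _ (fun i : 'I_k.+1 => (i : nat))).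
rewrite -map_comp.
rewrite (@eq_map _ _ _ (index^~ S \o F)); last first.
  by move=> a; rewrite /= ffunE inordK.
rewrite map_comp map_inj_in_uniq // => _ _ /mapP[x _ ->] /mapP[y _ ->].
by apply: (index_inj (F x)); rewrite mem_enum imset_f.
Qed.

(** Arcs are coloured by [f] of their head and vertices by [g], from disjoint palettes. The heads of
    the arcs of a geodesic are the members of [p]. *)
Lemma strc_le_heads (f g : V -> V) k :
    0 < k -> #|[set f x | x in setT]| + #|[set g x | x in setT]| <= k ->
    (forall u v p, geodesic e u v p -> {in p &, injective f}) ->
    (forall u v p, geodesic e u v p -> {in internal u p &, injective g}) ->
  strc sc <= k.
Proof.
move=> k_gt0 lek fP gP.
pose F (a : V + V * V) : V + V :=
  match a with inl x => inl (g x) | inr b => inr (f b.2) end.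
apply: (strc_le _ F _ k_gt0) => [|u v].
  apply: leq_trans lek.
  rewrite addnC -(card_imset _ (@inl_inj V V)) -(card_imset _ (@inr_inj V V)).
  apply: leq_trans (leq_card_setU _ _); apply/subset_leq_card/subsetP.
  by move=> _ /imsetP[[x|[x y]] _ ->]; rewrite inE /= !imset_f ?orbT.
have [p gp] := geodesic_exists (sc u v); exists p => //.
have /geodesicP[dp _] := gp.
have := dipath_uniq_elements dp; case/and3P: (dp) => _ _ /= /andP[_ up].
rewrite cat_uniq => /and3P[_ _ ui].
have {}ui : uniq (internal u p) by move: ui => /map_uniq.
rewrite map_cat -!map_comp cat_uniq; apply/and3P; split.
- rewrite (_ : map _ _ = map inr (map f p)).
    by rewrite map_inj_uniq ?(map_inj_in_uniq (fP _ _ _ gp)) // => ? ? [].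
  rewrite -[in RHS](@unzip2_zip _ _ (u :: p) p) ?leqW //.
  by rewrite /unzip2 -!map_comp.
- by apply/hasPn => _ /mapP[x _ ->]; apply/mapP => -[].
- rewrite map_inj_in_uniq // => x y xi yi [].
  exact: (gP _ _ _ gp).
Qed.

(** Three of [2 * #|V|] colours are saved: [f] sends [v] to [u], and [g] sends [z1] to [y1] and [z2]
    to [y2]. If [y1 = y2], three vertices share a colour, hence the last premise. *)
Lemma strc_le_merge u v y1 z1 y2 z2 :
    3 <= #|V| -> 3 <= dist u v -> (forall x y, dist x y <= dist u v) ->
    [/\ z1 != z2, y1 \notin [:: z1; z2] & y2 \notin [:: z1; z2]] ->
    internally_apart y1 z1 -> internally_apart y2 z2 ->
    (y1 = y2 -> internally_apart z1 z2) ->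
  strc sc <= 2 * #|V| - 3.
Proof.
move=> n3 d3 dmax [z12]; rewrite !inE !negb_or.
move=> /andP[y1z1 y1z2] /andP[y2z1 y2z2] a1 a2 a12.
pose f x := if x == v then u else x.
pose g x := if x == z1 then y1 else if x == z2 then y2 else x.
have neq_uv : u != v by rewrite -dist_gt0; lia.
apply: (strc_le_heads f g); first by lia.
- have lef : #|[set f x | x in setT]| <= #|[set~ v]|.
    apply/subset_leq_card/subsetP => _ /imsetP[x _ ->]; rewrite !inE /f.
    by case: (eqVneq x v).
  have leg : #|[set g x | x in setT]| <= #|~: [set z1; z2]|.
    apply/subset_leq_card/subsetP => _ /imsetP[x _ ->]; rewrite !inE /g.
    by have [_|neq1] := eqVneq x z1; [|have [_|neq2] := eqVneq x z2];
      rewrite negb_or ?y1z1 ?y2z1 ?neq1.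
  have := cardsC1 v; have := cardsC [set z1; z2]; rewrite cards2 z12 /=; lia.
- move=> a b p gp; have uvP : ~~ ((u \in p) && (v \in p)).
    (* The arcs leading up to [u] would push [dist a b] beyond the maximum [dist u v]. *)
    apply/negP => /andP[up vp].
    have := geodesic_order _ _ _ _ _ gp up vp d3; have := dmax a b.
    have : 0 < dist a u; last by lia.
    have /geodesicP[/and3P[_ _ /= /andP[aNp _]] _] := gp.
    by rewrite dist_gt0; apply: contraNneq aNp => ->.
  move=> x y xp yp; rewrite /f.
  by do 2![case: eqP => [?|_]] => // ?; subst; rewrite ?xp ?yp in uvP.
- move=> a b p gp x y xi yi; rewrite /g.
  have P1 := a1 _ _ _ gp; have P2 := a2 _ _ _ gp.
  have P12 e12 := a12 e12 _ _ _ gp.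
  do 4?[case: eqP => [?|_]] => E; subst;
    by [ | rewrite ?xi ?yi in P1 | rewrite ?xi ?yi in P2
         | have := P12 erefl; rewrite xi yi ].
Qed.

(** * Diameter at most 2, and at least 4 *)

Lemma strc_le_diam2 :
  0 < #|V| -> (forall u v, dist u v <= 2) -> strc sc <= #|V|.
Proof.
move=> n_gt0 dmax; pose pred w := odflt w [pick x | e x w].
pose F (a : V + V * V) : V :=
  match a with inl w => pred w | inr b => b.2 end.
apply: (strc_le _ F _ n_gt0) => [|u v]; first exact: max_card.
have [p gp] := geodesic_exists (sc u v); exists p => //.
have := dmax u v; rewrite -(geodesic_size _ _ _ gp).
have /geodesicP[/and3P[+ /eqP lp +] _] := gp.
case: p gp lp => [|w [|y [|z p]]] //= _ lp /andP[euw /andP[ewy _]] up _.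
(* The colours on [u -> w -> v] are [w], [v] and an in-neighbour [x] of [w], which exists because of
   [u] and is not [v] because [w -> v]. *)
subst y; rewrite /pred; case: pickP => [x exw|/(_ u)]; last by rewrite euw.
have neq_wv : w != v by apply: contraTneq ewy => ->; rewrite arc_irrefl.
have neq_xw : x != w by apply: contraTneq exw => ->; rewrite arc_irrefl.
have neq_xv : x != v.
  apply: contraTneq exw => ->.
  by have := proj2 tour w v neq_wv; rewrite ewy; case: (e v w).
by rewrite !inE negb_or neq_wv (eq_sym w) (eq_sym v) neq_xw neq_xv.
Qed.

(** The pairs [(u, v')] and [(u', v)] are at distance one less than the maximum, still at least 3,
    so [internally_apart_far] covers both. *)
Lemma strc_le_diam4 u v : 3 <= #|V| -> 4 <= dist u v ->
  (forall x y, dist x y <= dist u v) -> strc sc <= 2 * #|V| - 3.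
Proof.
move=> n3; case duv: (dist u v) => [//|k] k3 dmax.
have [u' euu' du'v] := dist_succ _ _ _ duv.
have [v' ev'v duv'] := dist_pred _ _ _ duv.
have du := dist_arc _ _ euu'; have dv := dist_arc _ _ ev'v.
have neq a b : a != b = (0 < dist a b) by rewrite dist_gt0.
apply: (strc_le_merge u v u v' u' v) => //.
- by rewrite duv; lia.
- by move=> x y; rewrite duv.
- rewrite !inE !negb_or !neq duv duv' du'v; split; last 2 first.
  + by lia.
  + by have := dist_triangle u' u v'; lia.
  by rewrite -neq; apply: contraTneq ev'v => ->; rewrite arc_irrefl.
- by apply: internally_apart_far; rewrite duv'; [lia|].
- by apply: internally_apart_far; rewrite du'v; [lia|].
- by move=> uu'; move: euu'; rewrite -uu' arc_irrefl.
Qed.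

(** * Diameter 3 *)

Lemma internally_apart_diam3 y z : y != z ->
    (forall a b, dist a b <= 3) ->
    (forall a b, dist a b = 3 -> dist a y = 1 -> dist y z = 1 -> dist z b = 1 ->
       False) ->
    (forall a b, dist a b = 3 -> dist a z = 1 -> dist z y = 1 -> dist y b = 1 ->
       False) ->
  internally_apart y z.
Proof.
move=> neq_yz dmax Hyz Hzy a b p gp; apply/negP => /andP[yi zi].
have [yp ay yb] := geodesic_internal _ _ _ _ gp yi.
have [zp az zb] := geodesic_internal _ _ _ _ gp zi.
have := dmax a b; have : 0 < dist y z by rewrite dist_gt0.
have : 0 < dist z y by rewrite dist_gt0 eq_sym.
(* Three positive distances with sum at most 3 are all equal to 1. *)
case: (geodesic_mem2 _ _ _ _ _ gp yp zp) => dab *;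
  [apply: (Hyz a b) | apply: (Hzy a b)]; lia.
Qed.

(* A geodesic a, y, z, b of length 3 would need c among its ends, since {a, b} meets
   {c, y}; but c is at distance 3 from y and from z in one of the two
   directions, which is impossible. *)
Lemma internally_apart_star c y z :
    (forall a b, dist a b <= 3) ->
    (forall a b a' b', dist a b = 3 -> dist a' b' = 3 ->
       (a \in [:: a'; b']) || (b \in [:: a'; b'])) ->
    y != z -> (dist c y == 3) || (dist y c == 3) ->
    (dist c z == 3) || (dist z c == 3) ->
  internally_apart y z.
Proof.
move=> dmax meet.
suff H y' z' : (dist c y' == 3) || (dist y' c == 3) ->
    (dist c z' == 3) || (dist z' c == 3) ->
    forall a b, dist a b = 3 -> dist a y' = 1 -> dist y' z' = 1 ->
      dist z' b = 1 -> False.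
  move=> yz cy cz; apply: internally_apart_diam3 => //; exact: H.
move=> cy cz a b dab day dyz dzb.
have tri := dist_triangle.
have nya : a != y' by rewrite -dist_gt0 day.
have nyb : y' != b.
  by apply/eqP => yb; have := tri y' a b; rewrite {2}yb dist_refl; lia.
have : (a == c) || (b == c).
  have : (a \in [:: c; y']) || (b \in [:: c; y']).
    by case/orP: cy => /eqP /(meet _ _ _ _ dab); rewrite !inE // orbC;
      case/orP=> /orP[] ->; rewrite ?orbT.
  by rewrite !inE (negPf nya) (eq_sym b y') (negPf nyb) !orbF.
case/orP => /eqP E; subst.
  have /dist_ge2/dist_arc : 2 <= dist c b by lia.
  have := tri y' c z'; have := tri b z' c; lia.
have /dist_ge2/dist_arc : 2 <= dist a c by lia.
have := tri a c y'; have := tri z' y' c; lia.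
Qed.

Lemma strc_le_diam3 u v : 3 <= #|V| -> dist u v = 3 ->
  (forall x y, dist x y <= 3) -> strc sc <= 2 * #|V| - 3.
Proof.
move=> n3 duv dmax.
have far y z : dist y z = 3 -> internally_apart y z.
  move=> dyz; apply: internally_apart_far; rewrite dyz // => a b.
  by apply: leq_trans (dmax a b) _.
have neq a b : dist a b = 3 -> a != b by rewrite -dist_gt0 => ->.
have dmaxuv a b : dist a b <= dist u v by rewrite duv.
have d3 : 3 <= dist u v by rewrite duv.
have merge y1 z1 y2 z2 := strc_le_merge u v y1 z1 y2 z2 n3 d3 dmaxuv.
pose meets (a b a' b' : V) := (a \in [:: a'; b']) || (b \in [:: a'; b']).
case: (boolP [exists q1 : V * V, exists q2 : V * V,
    [&& dist q1.1 q1.2 == 3, dist q2.1 q2.2 == 3 &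
        ~~ meets q1.1 q1.2 q2.1 q2.2]]).
  case/existsP => -[a b] /existsP[[a' b'] /= /and3P[/eqP dab /eqP dab']].
  rewrite /meets !inE !negb_or => /andP[/andP[aa' ab'] /andP[ba' bb']].
  apply: (merge a b a' b').
  - rewrite !inE !negb_or bb' (neq _ _ dab) ab' (eq_sym a') ba'.
    by rewrite (neq _ _ dab').
  - exact: far.
  - exact: far.
  - by move=> E; rewrite E eqxx in aa'.
rewrite negb_exists => /forallP Hmeet.
have {Hmeet} meet a b a' b' : dist a b = 3 -> dist a' b' = 3 -> meets a b a' b'.
  move=> dab dab'; have := Hmeet (a, b).
  rewrite negb_exists => /forallP/(_ (a', b')) /=.
  by rewrite dab dab' /= negbK.
pose Q c y := (dist c y == 3) || (dist y c == 3).
have farQ c y : Q c y -> internally_apart c y.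
  by case/orP => /eqP/far //; apply: internally_apartC.
have neqQ c y : Q c y -> c != y.
  by case/orP => /eqP/neq //; rewrite eq_sym.
(* Two pairs at distance 3 sharing [c] let [c], [y] and [z] carry one vertex colour. *)
have star c y z : y != z -> Q c y -> Q c z -> strc sc <= 2 * #|V| - 3.
  move=> yz cy cz; apply: (merge c y c z); try exact: farQ.
    by rewrite !inE !negb_or yz (neqQ _ _ cy) (neqQ _ _ cz).
  by move=> _; apply: (internally_apart_star c).
(* A second pair at distance 3 shares exactly one vertex with [(u, v)]: they meet, and [(v, u)] is
   ruled out by the arc from [v] to [u]. *)
case: (boolP [exists q : V * V, (q != (u, v)) && (dist q.1 q.2 == 3)]).
  case/existsP => -[a b] /= /andP[+ /eqP dab]; rewrite xpair_eqE negb_and.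
  have := meet _ _ _ _ dab duv; rewrite /meets !inE.
  have Quv : Q u v by rewrite /Q duv.
  have Qab : Q a b by rewrite /Q dab.
  have QC x y : Q x y = Q y x by rewrite /Q orbC.
  have nab := neq _ _ dab; have nuv := neq _ _ duv.
  have nba : (a, b) != (v, u).
    apply/eqP => -[E1 E2]; subst.
    have /dist_ge2/dist_arc : 2 <= dist u v by rewrite duv.
    by rewrite dab.
  case/orP => /orP[] /eqP E; subst; rewrite ?eqxx /= => H.
  - by apply: (star u b v).
  - by apply: (star v b u) => //; rewrite 1?QC //; apply: contraNneq nba => ->.
  - by apply: (star u a v) => //; rewrite 1?QC //; apply: contraNneq nba => ->.
  - by apply: (star v a u) => //; rewrite 1?QC //; move: H; rewrite ?orbF.
rewrite negb_exists => /forallP Huniq.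
have {Huniq} only a b : dist a b = 3 -> a = u /\ b = v.
  move=> dab; have := Huniq (a, b); rewrite /= dab eqxx andbT negbK.
  by case/eqP.
(* With [(u, v)] the only pair at distance 3, any third vertex [w] can share the colour of [u] and
   [v]: two internal vertices force a geodesic from [u] to [v], whose ends are not internal. *)
have [w] : exists w, w \in ~: [set u; v].
  apply/set0Pn; rewrite -card_gt0.
  by have := cardsC [set u; v]; rewrite cards2; lia.
rewrite !inE negb_or => /andP[wu wv].
have apart x : x \in [:: u; v] -> internally_apart x w.
  move=> xuv; apply: internally_apart_diam3
    => // [|a b /only[-> ->]|a b /only[-> ->]].
  - by apply: contraTneq xuv => ->; rewrite !inE negb_or wu wv.
  - by move: xuv; rewrite !inE => /orP[] /eqP->; rewrite ?dist_refl ?duv.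
  - by move: xuv; rewrite !inE => /orP[] /eqP->; rewrite ?dist_refl ?duv.
apply: (merge u v u w).
- by rewrite !inE !negb_or (eq_sym v) wv (neq _ _ duv) (eq_sym u) wu.
- exact: far.
- by apply: apart; rewrite !inE eqxx.
- by move=> _; apply: apart; rewrite !inE eqxx orbT.
Qed.

(** * Assembling the upper bound; the other two inequalities *)

Lemma strc_upper : 3 <= #|V| -> strc sc <= 2 * #|V| - 3.
Proof.
move=> n3; have /card_gt0P[x0 _] : 0 < #|V| by lia.
pose d (q : V * V) := dist q.1 q.2.
have [[u v] _ qmax] := @arg_maxnP _ (x0, x0) xpredT d isT.
have dmax x y : dist x y <= dist u v by apply: (qmax (x, y)).
have [d2|d3] := leqP (dist u v) 2.
  (* Diameter at most 2 costs [#|V|] colours, within the bound since [#|V|] is at least 3. *)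
  have le3 n : 3 <= n -> n <= 2 * n - 3 by lia.
  apply: leq_trans (le3 _ n3).
  by apply: strc_le_diam2 => [|x y]; [lia | have := dmax x y; lia].
have [d4|d3'] := leqP 4 (dist u v); first exact: (strc_le_diam4 u v n3 d4 dmax).
have duv : dist u v = 3 by lia.
by apply: (strc_le_diam3 u v) => // x y; rewrite -duv.
Qed.

Lemma trc_le_strc : trc sc <= strc sc.
Proof.
rewrite /trc; case: ex_minnP => m _; apply; rewrite /strc.
case: ex_minnP => k /existsP[c /strongly_total_rainbow_connectedP H] _.
apply/existsP; exists c; apply/total_rainbow_connectedP => u v.
by have [p /andP[dp _] rp] := H u v; exists p.
Qed.

(** Some pair of distinct vertices is not an arc; a path joining it has at least two arcs and an
    internal vertex, hence three colours. *)
Lemma trc_lower : 3 <= #|V| -> 3 <= trc sc.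
Proof.
move=> n3; have [u [v [neq_uv uv]]] : exists u v, u != v /\ ~~ e u v.
  have /card_gt1P[x [y [_ _ xy]]] : 1 < #|V| by lia.
  have := proj2 tour x y xy; case exy: (e x y) => /= eyx.
    by exists y, x; rewrite eq_sym.
  by exists x, y; rewrite exy.
rewrite /trc; case: ex_minnP => k /existsP[c /total_rainbow_connectedP H] _.
have [p /and3P[pp /eqP lp _]] := H u v.
case: p pp lp => [|x [|y p]] /=.
- by move=> _ E; rewrite E eqxx in neq_uv.
- by move=> /andP[eux _] E; rewrite -E eux in uv.
move=> _ _ /card_uniqP; set s := map _ _ => szs.
have := max_card (mem s); rewrite szs card_ord; apply: leq_trans.
by rewrite size_map size_cat !size_map /= size_belast; lia.
Qed.

End Distance.

Theorem theorem16 (V : finType) (e : rel V) (tour : tournament e)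
    (sc : strongly_connected e) (hn : 3 <= #|V|) :
  3 <= trc sc /\ trc sc <= strc sc /\ strc sc <= 2 * #|V| - 3.
Proof.
by split; [apply: trc_lower | split; [apply: trc_le_strc | apply: strc_upper]].
Qed.
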